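(* Let $k\ge 3$ and let $N_k^{gr}$ denote the algebra $N_k=\mathrm{span}\{I_k,E,E^2,\dots,E^{k-2},e_{12},\dots,e_{1k}\}\subseteq UT_k(F)$, $E=\sum_{i=1}^{k-1}e_{i,i+1}$, with the elementary grading induced by $(0,1,\dots,1)\in\mathbb{Z}_2^k$. Then $$C^{gr}(N_k^{gr})=\mathrm{Id}^{gr}(N_{k-1}^{gr})=\langle [y_1,y_2],\ [z,y_1,\dots,y_{k-2}],\ z_1z_2\rangle_{T_2}.$$
   Context: $F$ is a field of characteristic zero, $UT_k(F)$ the upper triangular $k\times k$ matrices with matrix units $e_{ij}$, $I_k$ the identity matrix. The elementary grading induced by $(g_1,\dots,g_k)$ makes $e_{ij}$ homogeneous of degree $g_j-g_i\in\mathbb{Z}_2$. A superalgebra is an algebra $A=A_0\oplus A_1$ with $A_iA_j\subseteq A_{i+j\bmod 2}$; $Z(A)$ is the center. $F\langle Y,Z\rangle$ is the free algebra on even variables $Y=\{y_1,y_2,\dots\}$ and odd variables $Z=\{z,z_1,z_2,\dots\}$. $\mathrm{Id}^{gr}(A)$ is the set of graded identities; $C^{gr}(A)$ the set of central graded polynomials (zero constant term, all evaluations with even variables in $A_0$ and odd in $A_1$ lie in $Z(A)$). $\langle S\rangle_{T_2}$ is the smallest ideal containing $S$ invariant under grading-preserving endomorphisms. Commutators are left-normed: $[a,b]=ab-ba$, $[a_1,\dots,a_m]=[[a_1,\dots,a_{m-1}],a_m]$. *)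

(* Defs.v *)
From HB Require Import structures.
From mathcomp Require Import all_boot all_order all_algebra.
Set Implicit Arguments. Unset Strict Implicit. Unset Printing Implicit Defensive.
Import GRing.Theory.
Local Open Scope ring_scope.

(* Graded variables: (false, i) = even variable y_i, (true, i) = odd variable
   z_i; the odd variable "z" is (true, 0). *)
Definition gvar := (bool * nat)%type.

Section FreeAlg.
Variable F : fieldType.

Inductive fterm : Type :=
| FVar of gvar
| FConst of F
| FAdd of fterm & fterm
| FMul of fterm & fterm.

(* The element of F<Y,Z> denoted by a term: its coefficient on each word
   (noncommutative monomial) in the variables. Two terms denote the same
   polynomial iff they have the same coefficient function. *)
Fixpoint fcoef (t : fterm) (w : seq gvar) : F :=
  match t with
  | FVar v => (w == [:: v])%:R
  | FConst c => if w is [::] then c else 0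
  | FAdd a b => fcoef a w + fcoef b w
  | FMul a b => \sum_(i < (size w).+1) fcoef a (take i w) * fcoef b (drop i w)
  end.

Definition word_deg (w : seq gvar) : bool := odd (count fst w).

Fixpoint fsubst (s : gvar -> fterm) (t : fterm) : fterm :=
  match t with
  | FVar v => s v
  | FConst c => FConst c
  | FAdd a b => FAdd (fsubst s a) (fsubst s b)
  | FMul a b => FMul (fsubst s a) (fsubst s b)
  end.

Definition graded_subst (s : gvar -> fterm) : Prop :=
  forall v w, fcoef (s v) w != 0 -> word_deg w = v.1.

(* T_2-ideal generated by S: smallest subset of F<Y,Z> containing S which is
   a two-sided ideal and stable under graded endomorphisms. Membership is
   stated for terms and is invariant under equality in F<Y,Z>. *)
Inductive T2ideal (S : fterm -> Prop) : fterm -> Prop :=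
| T2_gen t : S t -> T2ideal S t
| T2_eq t u : T2ideal S t -> (forall w, fcoef t w = fcoef u w) -> T2ideal S u
| T2_add t u : T2ideal S t -> T2ideal S u -> T2ideal S (FAdd t u)
| T2_mull t u : T2ideal S t -> T2ideal S (FMul u t)
| T2_mulr t u : T2ideal S t -> T2ideal S (FMul t u)
| T2_subst t s : T2ideal S t -> graded_subst s -> T2ideal S (fsubst s t).

Definition fcomm (a b : fterm) : fterm :=
  FAdd (FMul a b) (FMul (FConst (-1)) (FMul b a)).
Definition flcomm (a : fterm) (bs : seq fterm) : fterm := foldl fcomm a bs.

(* Matrices. Indices are 0-based: index 0 corresponds to row/column 1. *)
Definition eunit (k i j : nat) : 'M[F]_k :=
  \matrix_(r, s) ((r == i :> nat) && (s == j :> nat))%:R.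
Definition Emat (k : nat) : 'M[F]_k :=
  \matrix_(r, s) (s == r.+1 :> nat)%:R.
Definition Epow (k m : nat) : 'M[F]_k := iter m (fun M => M *m Emat k) 1%:M.

Definition Nk (k : nat) (a : 'M[F]_k) : Prop :=
  exists (c d : nat -> F),
    a = \sum_(m < k.-1) c m *: Epow k m + \sum_(1 <= j < k) d j *: eunit k 0 j.

(* Elementary grading induced by (0,1,...,1): e_ij is odd iff exactly one of
   i, j is the first index. Homogeneous component of degree b of N_k^gr. *)
Definition Nk_hom (k : nat) (b : bool) (a : 'M[F]_k) : Prop :=
  Nk a /\ forall i j : 'I_k,
    (((i == 0 :> nat) != (j == 0 :> nat)) != b) -> a i j = 0.

Fixpoint feval (k : nat) (r : gvar -> 'M[F]_k) (t : fterm) : 'M[F]_k :=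
  match t with
  | FVar v => r v
  | FConst c => c%:M
  | FAdd a b => feval r a + feval r b
  | FMul a b => feval r a *m feval r b
  end.

Definition Nk_assign (k : nat) (r : gvar -> 'M[F]_k) : Prop :=
  forall v, @Nk_hom k v.1 (r v).

Definition grId (k : nat) (t : fterm) : Prop :=
  forall r : gvar -> 'M[F]_k, Nk_assign r -> feval r t = 0.

Definition Nk_center (k : nat) (a : 'M[F]_k) : Prop :=
  Nk a /\ forall b, Nk b -> a *m b = b *m a.

Definition grCentral (k : nat) (t : fterm) : Prop :=
  fcoef t [::] = 0 /\
  forall r : gvar -> 'M[F]_k, Nk_assign r -> Nk_center (feval r t).

Definition y_ (i : nat) : fterm := FVar (false, i).
Definition z_ (i : nat) : fterm := FVar (true, i).

Definition gens37 (k : nat) (t : fterm) : Prop :=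
  t = fcomm (y_ 1) (y_ 2) \/
  t = flcomm (z_ 0) [seq y_ i | i <- iota 1 (k - 2)] \/
  t = FMul (z_ 1) (z_ 2).

End FreeAlg.

(* Main.v *)
Require Import Defs.
From HB Require Import structures.
From mathcomp Require Import all_boot all_order all_algebra.
From mathcomp Require Import generic_quotient boolp zify.
Set Implicit Arguments. Unset Strict Implicit. Unset Printing Implicit Defensive.
Import GRing.Theory.
Local Open Scope ring_scope.

(* Modulo the T_2-ideal J of the three generators, the even variables commute
   and a product of two odd elements vanishes.  On an odd element q, the
   operators q |-> y_i q and q |-> [q, y_i] all commute, right multiplication by
   y_i is their sum, and k - 2 commutators kill q.  Hence every polynomial is
   congruent to a combination of commutative monomials in the y_i and of
   monomials in these operators, with fewer than k - 2 commutators, applied to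
   some z_j.  Put E' = e_23 + ... + e_{k-1,k}.  Evaluating at
   y_i = c_i + u_i E', z_j = s_j e_12 sends such an odd monomial with q
   commutators to s_j c^a u^b e_{1,q+2}.  If all these evaluations vanish, or are
   central in N_k, then the entries (1, q+2) with q < k - 2 vanish, and linear
   independence of monomial functions kills the odd part.  The even part f dies
   because f(c) = 0 for an identity, while for a central polynomial the choice
   u = c makes the Euler derivative of f the entry (2,3), which must be 0.
   Conversely, all values on N_k of an element of J are multiples of e_{1k}. *)

(** * Expansion into words *)

Section Expansion.
Variable F : fieldType.
Implicit Types (t a b : fterm F) (w x y : seq gvar).

(** Only the cut after [size x] letters can give [x] and [y]. *)
Lemma cat_eq_sum w x y :
  \sum_(i < (size w).+1) (take i w == x)%:R * (drop i w == y)%:R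
    = (w == x ++ y)%:R :> F.
Proof.
have [->|neq] := eqVneq w (x ++ y); last first.
  rewrite big1 // => i _; rewrite -natrM mulnb; case: andP => // -[/eqP ex /eqP ey].
  by case/eqP: neq; rewrite -ex -ey cat_take_drop.
have sx : (size x < (size (x ++ y)).+1)%N by rewrite size_cat ltnS leq_addr.
rewrite (bigD1 (Ordinal sx)) //= take_size_cat // drop_size_cat // !eqxx mulr1.
rewrite big1 ?addr0 // => i /eqP nei; case: eqP => [ex|_]; last by rewrite mul0r.
case: nei; apply/val_inj => /=; move: (congr1 size ex).
by rewrite size_takel // -ltnS.
Qed.

(** Exhibits the finite support that [fcoef] leaves implicit, as a list of monomials with
    repetitions allowed; products become sums over pairs. *)
Fixpoint expansion t : seq (F * seq gvar) :=
  match t with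
  | FVar v => [:: (1, [:: v])]
  | FConst c => [:: (c, [::])]
  | FAdd a b => expansion a ++ expansion b
  | FMul a b => [seq (p.1 * q.1, p.2 ++ q.2) | p <- expansion a, q <- expansion b]
  end.

Lemma fcoefE t w : fcoef t w = \sum_(p <- expansion t) p.1 * (w == p.2)%:R.
Proof.
elim: t w => [v|c|a IHa b IHb|a IHa b IHb] w /=.
- by rewrite big_seq1 mul1r.
- by rewrite big_seq1; case: w => [|v w]; rewrite ?mulr1 ?mulr0.
- by rewrite big_cat /= IHa IHb.
rewrite big_allpairs_dep; under eq_bigr do rewrite IHa IHb mulr_suml.
rewrite exchange_big; apply: eq_bigr => p _ /=.
under eq_bigr do rewrite mulr_sumr.
rewrite exchange_big; apply: eq_bigr => q _ /=.
by rewrite -cat_eq_sum mulr_sumr; apply: eq_bigr => i _; rewrite mulrACA.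
Qed.

Lemma fcoef_mulE a b w : fcoef (FMul a b) w =
  \sum_(p <- expansion a) \sum_(q <- expansion b)
    p.1 * q.1 * (w == p.2 ++ q.2)%:R.
Proof. by rewrite fcoefE /= big_allpairs_dep. Qed.

Lemma fcoef_mulA a b c :
  fcoef (FMul a (FMul b c)) =1 fcoef (FMul (FMul a b) c).
Proof.
move=> w; rewrite !fcoef_mulE /= big_allpairs_dep /=; apply: eq_bigr => p _.
rewrite big_allpairs_dep; apply: eq_bigr => q _; apply: eq_bigr => s _ /=.
by rewrite mulrA catA.
Qed.

Lemma fcoef_mulC c t w : fcoef (FMul (FConst c) t) w = c * fcoef t w.
Proof.
rewrite fcoef_mulE big_seq1 fcoefE mulr_sumr.
by apply: eq_bigr => p _; rewrite mulrA.
Qed.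

Lemma fcoef_mulCr c t w : fcoef (FMul t (FConst c)) w = fcoef t w * c.
Proof.
rewrite fcoef_mulE fcoefE mulr_suml.
by apply: eq_bigr => p _; rewrite big_seq1 cats0 mulrAC.
Qed.

Lemma fcoef_mulDl a b c :
  fcoef (FMul (FAdd a b) c) =1 fcoef (FAdd (FMul a c) (FMul b c)).
Proof. by move=> w /=; rewrite -big_split; apply: eq_bigr => i _; rewrite mulrDl. Qed.

Lemma fcoef_mulDr a b c :
  fcoef (FMul a (FAdd b c)) =1 fcoef (FAdd (FMul a b) (FMul a c)).
Proof. by move=> w /=; rewrite -big_split; apply: eq_bigr => i _; rewrite mulrDr. Qed.

(** * Evaluation of polynomials at matrices *)

Definition weval (k : nat) (r : gvar -> 'M[F]_k) w : 'M[F]_k :=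
  foldr (fun v M => r v *m M) 1%:M w.

Lemma weval_cat k (r : gvar -> 'M[F]_k) x y :
  weval r (x ++ y) = weval r x *m weval r y.
Proof. by elim: x => [|v x IH] /=; rewrite ?mul1mx // IH mulmxA. Qed.

Lemma feval_expansion k (r : gvar -> 'M[F]_k) t :
  feval r t = \sum_(p <- expansion t) p.1 *: weval r p.2.
Proof.
elim: t => [v|c|a IHa b IHb|a IHa b IHb] /=.
- by rewrite big_seq1 /= scale1r mulmx1.
- by rewrite big_seq1 /= scalemx1.
- by rewrite big_cat /= IHa IHb.
rewrite big_allpairs_dep IHa IHb mulmx_suml; apply: eq_bigr => p _.
rewrite mulmx_sumr; apply: eq_bigr => q _ /=.
by rewrite weval_cat -scalemxAl -scalemxAr scalerA.
Qed.

Lemma feval_coef k (r : gvar -> 'M[F]_k) t (U : seq (seq gvar)) :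
  uniq U -> {subset [seq p.2 | p <- expansion t] <= U} ->
  feval r t = \sum_(w <- U) fcoef t w *: weval r w.
Proof.
move=> uU sU; under eq_bigr do rewrite fcoefE scaler_suml.
rewrite exchange_big feval_expansion; apply: eq_big_seq => p p_t /=.
rewrite (bigD1_seq p.2) //=; last by apply: sU; apply: map_f.
rewrite eqxx mulr1 big1 ?addr0 // => w /negPf ->.
by rewrite mulr0 scale0r.
Qed.

(** Evaluation is well defined on F<Y,Z>: both terms are summed over the union of their words. *)
Lemma feval_ext k (r : gvar -> 'M[F]_k) t u :
  fcoef t =1 fcoef u -> feval r t = feval r u.
Proof.
move=> tu; pose W := undup [seq p.2 | p <- expansion t ++ expansion u].
rewrite !(@feval_coef _ _ _ W) ?undup_uniq //; first by under eq_bigr do rewrite tu.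
all: by move=> w; rewrite mem_undup map_cat mem_cat => ->; rewrite ?orbT.
Qed.

Lemma feval_subst k (r : gvar -> 'M[F]_k) s t :
  feval r (fsubst s t) = feval (fun v => feval r (s v)) t.
Proof. by elim: t => //= [a -> b ->|a -> b ->]. Qed.

Lemma feval0 k t :
  feval (fun=> 0 : 'M[F]_k) t = (fcoef t [::])%:M.
Proof.
elim: t => [v|c|a IHa b IHb|a IHa b IHb] /=; first by rewrite raddf0.
- by [].
- by rewrite IHa IHb -raddfD.
- by rewrite IHa IHb big_ord1 scalar_mxM.
Qed.

(** Zero is homogeneous of both degrees; [graded_subst s] says that each [s v] is homogeneous of
    degree [v.1]. *)
Definition homog d t := forall w, fcoef t w != 0 -> word_deg w = d.

Lemma homog_var v : homog v.1 (FVar F v).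
Proof.
move=> w /=; case: (w =P [:: v]) => [-> _|_]; last by rewrite eqxx.
by rewrite /word_deg /= addn0 oddb.
Qed.

Lemma homog_add d a b : homog d a -> homog d b -> homog d (FAdd a b).
Proof.
move=> ha hb w /=; have [a0|/ha//] := eqVneq (fcoef a w) 0.
by rewrite a0 add0r => /hb.
Qed.

Lemma homog_scale d c a : homog d a -> homog d (FMul (FConst c) a).
Proof.
by move=> ha w; rewrite fcoef_mulC mulf_eq0 negb_or => /andP[_ /ha].
Qed.

Lemma homog_mul d e a b :
  homog d a -> homog e b -> homog (d (+) e) (FMul a b).
Proof.
move=> ha hb w /= nz.
have [i _ nzi] : exists2 i : 'I_(size w).+1, true &
    fcoef a (take i w) * fcoef b (drop i w) != 0.
  apply/exists_inP; apply: contraNT nz; rewrite negb_exists => /forallP z.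
  by rewrite big1 // => i _; apply/eqP; have:= z i; rewrite /= negbK.
move: nzi; rewrite mulf_eq0 negb_or => /andP[/ha <- /hb <-].
by rewrite /word_deg -oddD -count_cat cat_take_drop.
Qed.

Lemma homog_comm d a b : homog d a -> homog false b -> homog d (fcomm a b).
Proof.
move=> ha hb; apply: homog_add; last apply: homog_scale.
  by have:= homog_mul ha hb; rewrite addbF.
exact: homog_mul hb ha.
Qed.

End Expansion.

(** * Entrywise description of N_k *)

Section MatrixAlgebra.
Variables (F : fieldType) (K : nat).
Implicit Types (a b : 'M[F]_K) (c d : nat -> F).

(* Row 0 is unconstrained except for its diagonal entry. *)
Definition toeplitz c a := forall i j : 'I_K,
  (i != 0 :> nat) || (j == 0 :> nat) ->
  a i j = if (i <= j)%N then c (j - i)%N else 0.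

(** Coefficients of a product of power series, as for polynomials in [E]. *)
Definition conv c d n := \sum_(p < n.+1) c p * d (n - p)%N.

Lemma conv_comm c d : conv c d =1 conv d c.
Proof.
move=> n; rewrite /conv (reindex_inj rev_ord_inj) /=.
apply: eq_bigr => p _; have pn : (p <= n)%N by rewrite -ltnS.
by rewrite /= subSS subKn // mulrC.
Qed.

Lemma sum_interval_conv c d (i j : nat) : (j < K)%N ->
  \sum_(l < K) (if (i <= l <= j)%N then c (l - i)%N * d (j - l)%N else 0)
    = if (i <= j)%N then conv c d (j - i) else 0.
Proof.
move=> jK; case: leqP => ij; last first.
  by rewrite big1 // => l _; case: ifP => // /andP[/leq_trans h /h]; rewrite leqNgt ij.
rewrite -(big_mkord xpredT
  (fun l => if (i <= l <= j)%N then c (l - i)%N * d (j - l)%N else 0)).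
rewrite -big_mkcond /=.
under eq_bigl do rewrite andbC.
rewrite -(big_nat_widenl i 0 K (fun l => l <= j)%N) //.
rewrite -(big_nat_widen i j.+1 K xpredT) //.
rewrite -{1}(add0n i) big_addn big_mkord subSn //; apply: eq_bigr => p _.
by rewrite addnK addnC subnDA.
Qed.

(** In a constrained entry of the product, the free entries of row 0 meet only zero entries of
    column 0 below the diagonal. *)
Lemma toeplitz_mul c d a b :
  toeplitz c a -> toeplitz d b -> toeplitz (conv c d) (a *m b).
Proof.
move=> ta tb i j ij; rewrite mxE -sum_interval_conv //; apply: eq_bigr => l _.
have [l0|l0] := eqVneq (l : nat) 0%N.
  rewrite ta ?l0 ?orbT //; case: (eqVneq (i : nat) 0%N) ij => [i0 /= j0|i0 _].
    by rewrite tb ?j0 ?orbT // i0 l0 (eqP j0).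
  by rewrite leqn0 (negPf i0) mul0r.
rewrite tb ?l0 //; case: (eqVneq (i : nat) 0%N) ij => [i0 /= j0|i0 _].
  by rewrite (eqP j0) leqn0 (negPf l0) mulr0 andbF.
by rewrite ta ?i0 //; do 2!case: leqP => ?; rewrite ?mulr0 ?mul0r.
Qed.

Lemma EpowE m (i j : 'I_K) : Epow F K m i j = (j == (i + m)%N :> nat)%:R.
Proof.
elim: m i j => [|m IH] i j; first by rewrite mxE addn0 eq_sym.
rewrite [Epow _ _ _]/= mxE.
under eq_bigr do rewrite IH mxE -natrM mulnb.
have [imK|imK] := ltnP (i + m) K.
  rewrite (bigD1 (Ordinal imK)) //= eqxx addnS big1 ?addr0 // => l /eqP nel.
  by case: andP => // -[/eqP e _]; case: nel; apply: val_inj.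
rewrite big1; last by move=> l _; case: eqP => //; have:= ltn_ord l; lia.
by case: eqP => //; have:= ltn_ord j; lia.
Qed.

(** The powers of [E] give the constant diagonals, and the units [eunit F K 0 j] with j > 0 make row
    0 arbitrary off the diagonal. *)
Lemma NkP a : (2 <= K)%N -> Nk a <-> exists c, toeplitz c a.
Proof.
move=> K2; split=> [[c [d ->]]|[c ta]].
  (* Truncated because the powers stop at K - 2; the diagonal at distance K - 1 is a single free
     entry. *)
  exists (fun n => if (n < K.-1)%N then c n else 0) => i j ij.
  rewrite mxE !summxE [X in _ + X]big_nat [X in _ + X]big1 ?addr0; last first.
    move=> l /andP[l0 lK]; rewrite !mxE; case: andP => [[/eqP i0 /eqP jl]|_].
      by move: ij; rewrite i0 jl /= => /eqP e; rewrite e in l0.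
    by rewrite mulr0.
  under eq_bigr do rewrite mxE EpowE.
  case: (leqP i j) => lij; last first.
    by rewrite big1 // => m _; case: eqP => [e|_]; [lia|rewrite mulr0].
  case: (ltnP (j - i) K.-1) => lt; last first.
    rewrite big1 // => m _.
    by case: eqP => [e|_]; [have:= ltn_ord m; lia|rewrite mulr0].
  rewrite (bigD1 (Ordinal lt)) //= subnKC // eqxx mulr1 big1 ?addr0 // => m /eqP nem.
  by case: eqP => [e|_]; rewrite ?mulr0 //; case: nem; apply: val_inj => /=; lia.
have K0 : (0 < K)%N by lia.
pose o := Ordinal K0.
(* [d j] is what the powers of [E] leave over in row 0; the sum has one term and serves to use the
   number [j] as an index. *)
exists c, (fun j => \sum_(s < K | s == j :> nat) a o s - (if (j < K.-1)%N then c j else 0)).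
apply/matrixP => i j; rewrite mxE !summxE.
under eq_bigr do rewrite mxE EpowE.
under [X in _ + X]eq_bigr do rewrite !mxE.
have e1 : \sum_(m < K.-1) c m * (j == (i + m)%N :> nat)%:R =
   if ((i <= j) && (j - i < K.-1))%N then c (j - i)%N else 0.
  case: ifP => [/andP[ij lt]|h].
    rewrite (bigD1 (Ordinal lt)) //= subnKC // eqxx mulr1 big1 ?addr0 // => m /eqP nem.
    by case: eqP => [e|_]; rewrite ?mulr0 //; case: nem; apply: val_inj => /=; lia.
  rewrite big1 // => m _; case: eqP => [e|_]; rewrite ?mulr0 //.
  by have := ltn_ord m; lia.
rewrite e1; have [tij|] := boolP ((i != 0 :> nat) || (j == 0 :> nat)).
  rewrite ta // [X in _ + X]big_nat [X in _ + X]big1 ?addr0; last first.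
    move=> l /andP[l0 lK]; case: andP => [[/eqP i0 /eqP jl]|_]; last by rewrite mulr0.
    by move: tij; rewrite i0 jl; lia.
  by case: leqP => //= ij; case: ltnP => //; have := ltn_ord j; lia.
rewrite negb_or negbK => /andP[/eqP i0 j0].
have -> : i = o by apply: val_inj.
rewrite (bigD1_seq (j : nat)) ?iota_uniq //=; last by rewrite mem_index_iota lt0n j0 /=.
rewrite eqxx mulr1 subn0 [X in _ + (_ + X)]big1 ?addr0; last first.
  by move=> l /negPf nel; rewrite eq_sym nel mulr0.
rewrite (big_pred1 j); last by move=> s; apply/eqP/eqP => [/val_inj|->].
by rewrite addrC subrK.
Qed.

Lemma Nk_mul a b : (2 <= K)%N -> Nk a -> Nk b -> Nk (a *m b).
Proof.
move=> K2 /(NkP _ K2)[c ta] /(NkP _ K2)[d tb]; apply/NkP => //.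
by exists (conv c d); apply: toeplitz_mul.
Qed.

Lemma Nk_add a b : (2 <= K)%N -> Nk a -> Nk b -> Nk (a + b).
Proof.
move=> K2 /(NkP _ K2)[c ta] /(NkP _ K2)[d tb]; apply/NkP => //.
exists (fun n => c n + d n) => i j ij.
by rewrite mxE ta // tb //; case: ifP; rewrite ?addr0.
Qed.

Lemma toeplitz_scalar (x : F) : toeplitz (fun n => if n == 0 then x else 0) x%:M.
Proof.
move=> i j _; rewrite mxE -val_eqE; case: (ltngtP i j) => //= h; last first.
  by rewrite h subnn.
by rewrite subn_eq0 leqNgt h.
Qed.

Lemma Nk_scalar (x : F) : (2 <= K)%N -> Nk (x%:M : 'M_K).
Proof. by move=> K2; apply/NkP => //; eexists; apply: toeplitz_scalar. Qed.

Lemma Nk_feval (r : gvar -> 'M[F]_K) t :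
  (2 <= K)%N -> Nk_assign r -> Nk (feval r t).
Proof.
move=> K2 rK; elim: t => [v|x|t IHt u IHu|t IHt u IHu] /=.
- by case: (rK v).
- exact: Nk_scalar.
- exact: Nk_add.
- exact: Nk_mul.
Qed.

Lemma Nk_hom_scalar (x : F) : (2 <= K)%N -> Nk_hom false (x%:M : 'M_K).
Proof.
move=> K2; split; first exact: Nk_scalar.
move=> i j; rewrite mxE; case: (eqVneq i j) => [->|//].
by rewrite eqxx.
Qed.

Lemma Nk_hom_mul (d e : bool) a b : (2 <= K)%N ->
  Nk_hom d a -> Nk_hom e b -> Nk_hom (d (+) e) (a *m b).
Proof.
move=> K2 [Na ha] [Nb hb]; split; first exact: Nk_mul.
move=> i j ij; rewrite mxE big1 // => l _.
have [il|il] := boolP (((i == 0 :> nat) != (l == 0 :> nat)) != d).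
  by rewrite ha // mul0r.
rewrite hb ?mulr0 //; move: ij il.
by case: (i == 0 :> nat) (j == 0 :> nat) (l == 0 :> nat) (d) (e) => [] [] [] [] [].
Qed.

Lemma Nk_hom0 (d : bool) : (2 <= K)%N -> Nk_hom d (0 : 'M[F]_K).
Proof.
move=> K2; split; last by move=> i j _; rewrite mxE.
by rewrite -[0](raddf0 (@scalar_mx F K)); apply: Nk_scalar.
Qed.

Lemma Nk_hom_add (d : bool) a b : (2 <= K)%N ->
  Nk_hom d a -> Nk_hom d b -> Nk_hom d (a + b).
Proof.
move=> K2 [Na ha] [Nb hb]; split; first exact: Nk_add.
by move=> i j ij; rewrite mxE ha // hb // addr0.
Qed.

Lemma Nk_hom_scale (d : bool) (x : F) a : (2 <= K)%N -> Nk_hom d a -> Nk_hom d (x *: a).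
Proof.
move=> K2 ha; rewrite -mul_scalar_mx -[d]addFb.
by apply: Nk_hom_mul ha => //; apply: Nk_hom_scalar.
Qed.

Lemma Nk_hom_weval (r : gvar -> 'M[F]_K) w :
  (2 <= K)%N -> Nk_assign r -> Nk_hom (word_deg w) (weval r w).
Proof.
move=> K2 rK; elim: w => [|v w IH]; first exact: Nk_hom_scalar.
by rewrite /word_deg /= oddD oddb; apply: Nk_hom_mul.
Qed.

(** This makes an assignment composed with a graded substitution admissible again. *)
Lemma Nk_hom_feval (r : gvar -> 'M[F]_K) (d : bool) t :
  (2 <= K)%N -> Nk_assign r -> homog d t -> Nk_hom d (feval r t).
Proof.
move=> K2 rK ht.
rewrite (@feval_coef _ _ _ _ (undup [seq p.2 | p <- expansion t])) ?undup_uniq //.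
  elim/big_rec: _ => [|w a _ ha]; first exact: Nk_hom0.
  have [->|/ht hd] := eqVneq (fcoef t w) 0; first by rewrite scale0r add0r.
  by apply: Nk_hom_add => //; apply: Nk_hom_scale; rewrite // -hd; apply: Nk_hom_weval.
by move=> w; rewrite mem_undup.
Qed.

End MatrixAlgebra.

(** * Values of the T_2-ideal *)

Section Soundness.
Variables (F : fieldType) (K : nat).
Hypothesis K2 : (2 <= K)%N.
Implicit Types (a b : 'M[F]_K).

Lemma Nk_lower0 a (i j : 'I_K) : Nk a -> (j < i)%N -> a i j = 0.
Proof.
move=> /(NkP _ K2)[c ta] ji; rewrite ta; first by rewrite leqNgt ji.
by rewrite -lt0n (leq_ltn_trans (leq0n j) ji).
Qed.

Lemma Nk_diag_const a : Nk a -> exists x, forall i, a i i = x.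
Proof.
move=> /(NkP _ K2)[c ta]; exists (c 0%N) => i.
by rewrite ta ?leqnn ?subnn //; case: (i : nat).
Qed.

(** Constrained entries are convolutions, which commute; in the rest of row 0 evenness makes both
    products zero. *)
Lemma Nk_even_comm a b : Nk_hom false a -> Nk_hom false b -> a *m b = b *m a.
Proof.
move=> ha hb; have [_ Eab] := Nk_hom_mul K2 ha hb.
have [_ Eba] := Nk_hom_mul K2 hb ha.
have [/(NkP _ K2)[c ta] _] := ha; have [/(NkP _ K2)[d tb] _] := hb.
apply/matrixP => i j; have [ij|] := boolP ((i != 0 :> nat) || (j == 0 :> nat)).
  by rewrite (toeplitz_mul ta tb) // (toeplitz_mul tb ta) //; case: ifP; rewrite // conv_comm.
rewrite negb_or negbK => /andP[i0 /negPf j0].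
by rewrite Eab ?Eba // i0 j0.
Qed.

(** Upper triangularity removes column 0, so an odd matrix is supported on row 0. *)
Lemma Nk_odd_row0 a (i j : 'I_K) :
  Nk_hom true a -> (i != 0 :> nat) || (j == 0 :> nat) -> a i j = 0.
Proof.
move=> [Na ha] ij; case: (eqVneq (i : nat) 0%N) ij => [i0 /= j0|i0 _].
  by apply: ha; rewrite i0 j0.
case: (eqVneq (j : nat) 0%N) => [j0|j0]; last by apply: ha; rewrite (negPf i0) (negPf j0).
by apply: Nk_lower0 => //; rewrite j0 lt0n.
Qed.

Lemma Nk_odd_mul0 a b : Nk_hom true a -> Nk_hom true b -> a *m b = 0.
Proof.
move=> ha hb; apply/matrixP => i j; rewrite !mxE big1 // => l _.
have [l0|l0] := eqVneq (l : nat) 0%N.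
  by rewrite (Nk_odd_row0 ha) ?l0 ?orbT // mul0r.
by rewrite (Nk_odd_row0 hb) ?l0 // mulr0.
Qed.

(* Commuting an odd matrix with an even one shifts its first row to the right,
   since the diagonal of the even matrix is constant. *)
Lemma Nk_comm_shift m a b :
  Nk_hom true a -> Nk_hom false b ->
  (forall i j : 'I_K, (j < m)%N -> a i j = 0) ->
  forall i j : 'I_K, (j < m.+1)%N -> (a *m b - b *m a) i j = 0.
Proof.
move=> ha [Nb hb] am i j; rewrite ltnS => jm; rewrite !mxE.
have [x bx] := Nk_diag_const Nb.
rewrite [X in X - _](bigD1 j) //= [X in _ - X](bigD1 i) //= !bx mulrC.
rewrite [X in _ + X - _]big1; last first.
  move=> l /negPf nel; have [lj|jl|/val_inj lj] := ltngtP l j.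
  - by rewrite am ?mul0r //; apply: leq_trans lj jm.
  - by rewrite [b l j]Nk_lower0 ?mulr0.
  - by rewrite lj eqxx in nel.
rewrite big1 ?addr0 ?subrr // => l nel.
have [l0|l0] := eqVneq (l : nat) 0%N; last by rewrite (Nk_odd_row0 ha) ?l0 ?mulr0.
rewrite hb ?mul0r // l0 eqxx; case: (nat_of_ord i =P 0%N) => //= i0.
by case/eqP: nel; apply: val_inj; rewrite /= l0 i0.
Qed.

Lemma feval_comm (r : gvar -> 'M[F]_K) t u :
  feval r (fcomm t u) = feval r t *m feval r u - feval r u *m feval r t.
Proof. by rewrite /= mul_scalar_mx scaleN1r. Qed.

(** Each commutator clears one more column, starting from column 0; k - 2 of them leave only the
    last column of a k by k matrix. *)
Lemma feval_flcomm_shift (r : gvar -> 'M[F]_K) (ys : seq nat) :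
  Nk_assign r ->
  Nk_hom true (feval r (flcomm (z_ F 0) [seq y_ F l | l <- ys])) /\
  forall i j : 'I_K, (j < (size ys).+1)%N ->
  feval r (flcomm (z_ F 0) [seq y_ F l | l <- ys]) i j = 0.
Proof.
move=> rK; elim/last_ind: ys => [|ys y [IHh IH]].
  split=> [|i j]; first exact: (rK (true, 0%N)).
  rewrite ltnS leqn0 => j0; apply: (Nk_odd_row0 (rK (true, 0%N))).
  by rewrite j0 orbT.
rewrite map_rcons /flcomm foldl_rcons -/(flcomm _ _) feval_comm size_rcons.
have hy : Nk_hom false (feval r (y_ F y)) := rK (false, y).
split; last exact: Nk_comm_shift.
apply: Nk_hom_add => //; first exact: (Nk_hom_mul K2 IHh hy).
by rewrite -scaleN1r; apply: Nk_hom_scale => //; apply: (Nk_hom_mul K2 hy IHh).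
Qed.

(** * Multiples of e_{1k} in matrices of size [K <= k] *)

Variable k : nat.
Hypothesis Kk : (K <= k)%N.

(* For [K < k] this says [a = 0]. *)
Definition corner a := forall i j : 'I_K,
  ~~ ((i == 0 :> nat) && (j == k.-1 :> nat)) -> a i j = 0.

(** As [b] is upper triangular, e_{1k} b is a multiple of e_{1k}. *)
Lemma corner_mulr a b : corner a -> Nk b -> corner (a *m b).
Proof.
move=> ca Nb i j ij; rewrite mxE big1 // => l _.
have [/andP[i0 lk]|il] := boolP ((i == 0 :> nat) && (l == k.-1 :> nat)); last first.
  by rewrite ca ?mul0r.
rewrite i0 /= in ij; rewrite [b l j]Nk_lower0 ?mulr0 // (eqP lk) ltn_neqAle ij /=.
by have := ltn_ord j; lia.
Qed.

Lemma corner_mull a b : corner a -> Nk b -> corner (b *m a).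
Proof.
move=> ca Nb i j ij; rewrite mxE big1 // => l _.
have [/andP[l0 jk]|lj] := boolP ((l == 0 :> nat) && (j == k.-1 :> nat)); last first.
  by rewrite ca ?mulr0.
rewrite jk andbT in ij.
by rewrite Nk_lower0 ?mul0r // (eqP l0) lt0n.
Qed.

Hypothesis k2 : (2 <= k)%N.

(** Multiplication by [b] on either side scales the corner entry by the common diagonal value of
    [b]. *)
Lemma corner_center a : Nk a -> corner a -> Nk_center a.
Proof.
move=> Na ca; split=> // b Nb; apply/matrixP => i j.
have [/andP[/eqP i0 /eqP jk]|ij] := boolP ((i == 0 :> nat) && (j == k.-1 :> nat)); last first.
  by rewrite (corner_mulr ca) // (corner_mull ca).
have [x bx] := Nk_diag_const Nb.
rewrite !mxE (bigD1 j) //= [RHS](bigD1 i) //= !bx mulrC.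
rewrite !big1 // => l nel; rewrite ca ?mulr0 ?mul0r //.
  by rewrite jk eqxx andbT -i0 val_eqE.
by rewrite i0 -jk /= val_eqE.
Qed.

(** The generators take corner values, ideal operations preserve them, and a graded substitution
    amounts to another admissible assignment. Both K = k and K = k - 1 are used below. *)
Lemma T2ideal_corner t : T2ideal (gens37 (F := F) k) t ->
  forall r, Nk_assign r -> corner (feval r t).
Proof.
elim=> {t} [t [->|[->|->]]|t u _ IH tu|t u _ IHt _ IHu|t u _ IH|t u _ IH|t s _ IH gs] r rK.
- rewrite feval_comm (Nk_even_comm (rK (false, 1%N)) (rK (false, 2%N))) subrr.
  by move=> i j _; rewrite mxE.
- move=> i j ij; have [h0 h] := feval_flcomm_shift (iota 1 (k - 2)) rK.
  have [i0|i0] := eqVneq (i : nat) 0%N; last by rewrite (Nk_odd_row0 h0) ?i0.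
  rewrite h // size_iota; rewrite i0 /= in ij.
  by have := ltn_ord j; lia.
- rewrite /= (Nk_odd_mul0 (rK (true, 1%N)) (rK (true, 2%N))).
  by move=> i j _; rewrite mxE.
- by rewrite -(feval_ext r tu); apply: IH.
- by move=> i j ij /=; rewrite mxE (IHt _ rK) // (IHu _ rK) // addr0.
- by apply: corner_mull (IH _ rK) _; apply: Nk_feval.
- by apply: corner_mulr (IH _ rK) _; apply: Nk_feval.
- rewrite feval_subst; apply: IH => v.
  by apply: Nk_hom_feval => // w /gs.
Qed.

End Soundness.

(** * Linear independence of monomial functions *)

Section MonomialIndependence.
Variables (F : fieldType) (T : eqType).
Hypothesis charF0 : [pchar F] =i pred0.
Implicit Types (v : T -> F) (m : seq T) (L : seq (F * seq T)).

Definition monomial v m := \prod_(x <- m) v x.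

Lemma monomial_sep m n : ~~ perm_eq m n -> exists v, monomial v m != monomial v n.
Proof.
move=> mn; have [x xmn] : exists x, count_mem x m != count_mem x n.
  case/allPn: mn => x _ xmn; exists x; exact: xmn.
(* The values are powers of 2 with different exponents, which stay distinct in characteristic
   zero. *)
exists (fun y => if y == x then 2 else 1).
have E s : monomial (fun y => if y == x then 2 else 1 : F) s = (2 ^ count_mem x s)%:R.
  by rewrite /monomial -big_mkcond /= big_const_seq iter_mulr_1 natrX.
have natF n1 n2 : n1%:R = n2%:R :> F -> (n1 <= n2)%N.
  move=> e; case: (leqP n2 n1) => [h|/ltnW //].
  by rewrite -subn_eq0 -((pcharf0P F).1 charF0) natrB // e subrr.
apply: contra xmn; rewrite !E => /eqP e.
by rewrite -(@eqn_exp2l 2) // eqn_leq !natF.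
Qed.

(* Dedekind's argument: multiplying the relation by [monomial v - monomial v n]
   for a separating [v] kills the class of [n] and keeps that of [m]. *)
Lemma monomial_isolate L m (N : seq (seq T)) :
  (forall v, \sum_(x <- L) x.1 * monomial v x.2 = 0) ->
  (forall n, n \in N -> ~~ perm_eq m n) ->
  exists wt : seq T -> F, [/\ wt m != 0,
    forall n, perm_eq m n -> wt n = wt m,
    forall n, n \in N -> wt n = 0 &
    forall v, \sum_(x <- L) x.1 * wt x.2 * monomial v x.2 = 0].
Proof.
move=> L0; elim: N => [|n N IH] mN.
  exists (fun=> 1); split=> //; first exact: oner_neq0.
  by move=> v; under eq_bigr do rewrite mulr1.
case: IH => [p pN|wt [wm wc wN w0]]; first by apply: mN; rewrite inE pN orbT.
have [v vmn] := monomial_sep (mN n (mem_head _ _)).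
exists (fun p => wt p * (monomial v p - monomial v n)); split.
- by rewrite mulf_neq0 // subr_eq0.
- by move=> p mp; rewrite wc // /monomial (perm_big _ mp).
- by move=> p; rewrite inE => /orP[/eqP ->|/wN ->]; rewrite ?subrr ?mulr0 ?mul0r.
move=> u; transitivity (\sum_(x <- L) x.1 * wt x.2 * monomial (fun y => v y * u y) x.2
   - monomial v n * \sum_(x <- L) x.1 * wt x.2 * monomial u x.2).
  rewrite mulr_sumr -sumrB; apply: eq_bigr => x _.
  rewrite /monomial big_split /= mulrA mulrBr mulrBl -!mulrA; congr (_ - _).
  by rewrite [RHS]mulrCA; congr (_ * _); rewrite [RHS]mulrCA.
by rewrite !w0 mulr0 subrr.
Qed.

(** Isolating the class of [m] against the other monomials of [L] and evaluating at the constant 1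
    leaves a nonzero weight times the coefficient sum. *)
Lemma monomial_indep L :
  (forall v, \sum_(x <- L) x.1 * monomial v x.2 = 0) ->
  forall m, \sum_(x <- L | perm_eq m x.2) x.1 = 0.
Proof.
move=> L0 m; have [|wt [wm wc wN w0]] :=
  @monomial_isolate L m [seq x.2 | x <- L & ~~ perm_eq m x.2] L0.
  by move=> n /mapP[x]; rewrite mem_filter => /andP[h _] ->.
have := w0 (fun=> 1); rewrite (bigID (fun x => perm_eq m x.2)) /=.
rewrite [X in _ + X]big_seq_cond [X in _ + X]big1 => [|x /andP[xL mx]]; last first.
  by rewrite wN ?mulr0 ?mul0r //; apply/mapP; exists x; rewrite ?mem_filter ?mx.
rewrite addr0; under eq_bigr => x mx do rewrite wc // /monomial big1 // mulr1.
by rewrite -mulr_suml => /eqP; rewrite mulf_eq0 (negPf wm) orbF => /eqP.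
Qed.

End MonomialIndependence.

(** Turns vanishing class sums, as delivered by [monomial_indep], into vanishing of a combination
    whose terms depend only on the class. The induction removes the whole class of the head. *)
Lemma sum_classes_eq0 (A V : zmodType) (I : eqType) (e : rel I)
    (g : A -> I -> V) (L : seq (A * I)) :
  reflexive e -> (forall i j, e i j -> e i =1 e j) ->
  (forall i, {morph g^~ i : a b / a + b}) ->
  (forall i j, e i j -> g^~ i =1 g^~ j) ->
  (forall i, \sum_(x <- L | e i x.2) x.1 = 0) ->
  \sum_(x <- L) g x.1 x.2 = 0.
Proof.
move=> er et gD ge; have g0 i : g 0 i = 0.
  by apply: (addIr (g 0 i)); rewrite -gD !add0r.
have [n] := ubnP (size L); elim: n L => // n IH [|[a i] L]; first by rewrite big_nil.
rewrite ltnS => sL L0; rewrite (bigID (fun x => e i x.2)) /=.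
rewrite (eq_bigr (fun x => g x.1 i)); last by move=> x /ge.
rewrite -(big_morph (g^~ i) (gD i) (g0 i)) L0 g0 add0r -big_filter IH //.
  rewrite /= er /=; apply: leq_trans sL; rewrite ltnS size_filter; exact: count_size.
move=> j; rewrite big_filter_cond; have [ij|ij] := boolP (e i j).
  by rewrite big1 // => x /andP[/negP + jx]; rewrite (et _ _ ij) jx.
rewrite -[RHS](L0 j) [RHS](bigID (fun x => e i x.2)) /=.
rewrite [X in _ = X + _]big1 ?add0r; last first.
  by move=> x /andP[/et jx ix]; move: ij; rewrite (et _ _ ix) -jx er.
by apply: eq_bigl => x; rewrite andbC.
Qed.

(** * The relatively free algebra *)

(** The quotient construction requires a choice type; both structures are provided classically. *)
HB.instance Definition _ (F : fieldType) := gen_eqMixin (fterm F).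
HB.instance Definition _ (F : fieldType) := gen_choiceMixin (fterm F).

Section QuotientRing.
Local Open Scope quotient_scope.
Variables (F : fieldType) (k : nat).
Implicit Types (t u a b c : fterm F).

Local Notation J := (T2ideal (gens37 (F := F) k)).

Definition fopp t := FMul (FConst (-1)) t.

Lemma fcoef_add t u w : fcoef (FAdd t u) w = fcoef t w + fcoef u w.
Proof. by []. Qed.

Lemma fcoef_opp t w : fcoef (fopp t) w = - fcoef t w.
Proof. by rewrite fcoef_mulC mulN1r. Qed.

Lemma fcoef_mulCA x t u w :
  fcoef (FMul t (FMul (FConst x) u)) w = x * fcoef (FMul t u) w.
Proof.
transitivity (\sum_(i < (size w).+1)
  fcoef t (take i w) * fcoef (FMul (FConst x) u) (drop i w)) => //.
by under eq_bigr do rewrite fcoef_mulC mulrCA; rewrite -mulr_sumr.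
Qed.

Definition modJ t u := `[< J (FAdd t (fopp u)) >].

Lemma J_zero t : fcoef t =1 (fun=> 0) -> J t.
Proof.
(* Zero is obtained as 0 times the generator z_1 z_2. *)
move=> t0; apply: (@T2_eq _ _ (FMul (FConst 0) (FMul (z_ F 1) (z_ F 2)))).
  by apply/T2_mull/T2_gen; right; right.
by move=> w; rewrite fcoef_mulC mul0r t0.
Qed.

Lemma modJ_coef t u : fcoef t =1 fcoef u -> modJ t u.
Proof.
by move=> tu; apply/asboolP/J_zero => w; rewrite fcoef_add fcoef_opp tu subrr.
Qed.

Lemma modJ_refl : reflexive modJ.
Proof. by move=> t; apply: modJ_coef. Qed.

Lemma modJ_imp t u : modJ t u -> modJ u t.
Proof.
move=> /asboolP tu; apply/asboolP; apply: (T2_eq (T2_mull (FConst (-1)) tu)) => w.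
by rewrite fcoef_mulC !fcoef_add !fcoef_opp mulN1r opprB addrC.
Qed.

Lemma modJ_sym : symmetric modJ.
Proof. by move=> t u; apply/idP/idP; apply: modJ_imp. Qed.

Lemma modJ_trans : transitive modJ.
Proof.
move=> u t v /asboolP tu /asboolP uv; apply/asboolP.
apply: (T2_eq (T2_add tu uv)) => w.
by rewrite !fcoef_add !fcoef_opp addrA subrK.
Qed.

Canonical modJ_equiv := EquivRel modJ modJ_refl modJ_sym modJ_trans.

Definition relfree := {eq_quot modJ_equiv}.
HB.instance Definition _ := Choice.on relfree.
HB.instance Definition _ := EqQuotient.on relfree.

Definition cls t : relfree := \pi_relfree t.

Lemma clsP t u : cls t = cls u <-> modJ t u.
Proof. exact: (rwP (@eqmodP _ modJ_equiv t u)). Qed.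

Lemma cls_coef t u : fcoef t =1 fcoef u -> cls t = cls u.
Proof. by move=> /modJ_coef/clsP. Qed.

Lemma cls_ind (P : relfree -> Prop) : (forall t, P (cls t)) -> forall q, P q.
Proof. by move=> Pt q; rewrite -[q]reprK. Qed.

Lemma modJ_add t t' u u' : modJ t t' -> modJ u u' -> modJ (FAdd t u) (FAdd t' u').
Proof.
move=> /asboolP tt' /asboolP uu'; apply/asboolP.
apply: (T2_eq (T2_add tt' uu')) => w.
by rewrite !fcoef_add !fcoef_opp fcoef_add opprD addrACA.
Qed.

Lemma modJ_mul t t' u u' : modJ t t' -> modJ u u' -> modJ (FMul t u) (FMul t' u').
Proof.
move=> /asboolP tt' /asboolP uu'; apply: (@modJ_trans (FMul t' u)); apply/asboolP.
  apply: (T2_eq (T2_mulr u tt')) => w.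
  rewrite fcoef_mulDl !fcoef_add fcoef_opp; congr (_ + _).
  by rewrite -fcoef_mulA fcoef_mulC mulN1r.
apply: (T2_eq (T2_mull t' uu')) => w.
by rewrite fcoef_mulDr !fcoef_add fcoef_opp fcoef_mulCA mulN1r.
Qed.

Definition qadd (p q : relfree) := cls (FAdd (repr p) (repr q)).
Definition qopp (p : relfree) := cls (fopp (repr p)).
Definition qmul (p q : relfree) := cls (FMul (repr p) (repr q)).

Lemma modJ_repr t : modJ (repr (cls t)) t.
Proof. by apply/clsP; rewrite /cls reprK. Qed.

Lemma clsD t u : cls (FAdd t u) = qadd (cls t) (cls u).
Proof. by apply/esym/clsP/modJ_add; apply: modJ_repr. Qed.

Lemma clsM t u : cls (FMul t u) = qmul (cls t) (cls u).
Proof. by apply/esym/clsP/modJ_mul; apply: modJ_repr. Qed.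

Lemma clsN t : cls (fopp t) = qopp (cls t).
Proof. by apply/esym/clsP/modJ_mul; rewrite ?modJ_refl ?modJ_repr. Qed.

Fact qaddA : associative qadd.
Proof.
elim/cls_ind=> t; elim/cls_ind=> u; elim/cls_ind=> v; rewrite -!clsD.
by apply: cls_coef => w; rewrite !fcoef_add addrA.
Qed.

Fact qaddC : commutative qadd.
Proof.
elim/cls_ind=> t; elim/cls_ind=> u; rewrite -!clsD.
by apply: cls_coef => w; rewrite !fcoef_add addrC.
Qed.

Fact qadd0 : left_id (cls (FConst 0)) qadd.
Proof.
elim/cls_ind=> t; rewrite -!clsD; apply: cls_coef => -[|v w]; exact: add0r.
Qed.

Fact qaddN : left_inverse (cls (FConst 0)) qopp qadd.
Proof.
elim/cls_ind=> t; rewrite -clsN -clsD; apply: cls_coef => w.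
by rewrite fcoef_add fcoef_opp addNr; case: w.
Qed.

HB.instance Definition _ := GRing.isZmodule.Build relfree qaddA qaddC qadd0 qaddN.

Fact qmulA : associative qmul.
Proof.
elim/cls_ind=> t; elim/cls_ind=> u; elim/cls_ind=> v; rewrite -!clsM.
exact/cls_coef/fcoef_mulA.
Qed.

Fact qmul1 : left_id (cls (FConst 1)) qmul.
Proof.
elim/cls_ind=> t; rewrite -clsM; apply: cls_coef => w.
by rewrite fcoef_mulC mul1r.
Qed.

Fact qmulr1 : right_id (cls (FConst 1)) qmul.
Proof.
elim/cls_ind=> t; rewrite -clsM; apply: cls_coef => w.
by rewrite fcoef_mulCr mulr1.
Qed.

Fact qmulDl : left_distributive qmul +%R.
Proof.
elim/cls_ind=> t; elim/cls_ind=> u; elim/cls_ind=> v.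
rewrite -[_ + _]clsD -!clsM -[RHS]clsD; exact/cls_coef/fcoef_mulDl.
Qed.

Fact qmulDr : right_distributive qmul +%R.
Proof.
elim/cls_ind=> t; elim/cls_ind=> u; elim/cls_ind=> v.
rewrite -[_ + _]clsD -!clsM -[RHS]clsD; exact/cls_coef/fcoef_mulDr.
Qed.

HB.instance Definition _ :=
  GRing.Zmodule_isPzRing.Build relfree qmulA qmul1 qmulr1 qmulDl qmulDr.

Lemma cls_add t u : cls (FAdd t u) = cls t + cls u.
Proof. exact: clsD. Qed.

Lemma cls_mul t u : cls (FMul t u) = cls t * cls u.
Proof. exact: clsM. Qed.

Lemma cls_eq0 t : cls t = 0 <-> J t.
Proof.
split=> [/clsP/asboolP tJ|tJ].
  apply: (T2_eq tJ) => w; rewrite fcoef_add fcoef_opp.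
  by case: w => [|? ?]; rewrite /= subr0.
apply/clsP/asboolP/(T2_eq tJ) => w; rewrite fcoef_add fcoef_opp.
by case: w => [|? ?]; rewrite /= subr0.
Qed.

(** Scalars as central ring elements, in place of an algebra structure over [F]. *)
Definition scal (c : F) : relfree := cls (FConst c).

Lemma scalD : {morph scal : x y / x + y}.
Proof.
by move=> x y; rewrite -cls_add; apply: cls_coef => -[|? ?] /=; rewrite ?addr0.
Qed.

Lemma scalM : {morph scal : x y / x * y}.
Proof.
move=> x y; rewrite -cls_mul; apply: cls_coef => w; rewrite fcoef_mulC.
by case: w => //= _ _; rewrite mulr0.
Qed.

Lemma scalC x (q : relfree) : scal x * q = q * scal x.
Proof.
elim/cls_ind: q => t; rewrite -!cls_mul; apply: cls_coef => w.
by rewrite fcoef_mulC fcoef_mulCr mulrC.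
Qed.

Lemma cls_comm t u : cls (fcomm t u) = cls t * cls u - cls u * cls t.
Proof. by rewrite cls_add -!cls_mul; congr (_ + _); apply: clsN. Qed.

End QuotientRing.

(** * Normal form modulo the T_2-ideal *)

Lemma foldr_perm (T : eqType) (V : Type) (f : T -> V -> V) q s1 s2 :
  (forall x y p, f x (f y p) = f y (f x p)) ->
  perm_eq s1 s2 -> foldr f q s1 = foldr f q s2.
Proof.
move=> fC; elim: s1 s2 => [|x s1 IH] s2; first by rewrite perm_sym => /perm_nilP ->.
move=> s12; have xs2 : x \in s2 by rewrite -(perm_mem s12) mem_head.
move: s12; case/splitPr: xs2 => p1 p2.
have -> : perm_eq (x :: s1) (p1 ++ x :: p2) = perm_eq s1 (p1 ++ p2).
  by rewrite -[x :: p2]cat1s perm_sym perm_catCA /= perm_cons perm_sym.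
move=> /IH /= ->; by elim: p1 => //= y p1 <-.
Qed.

Section NormalForm.
Variables (F : fieldType) (k : nat).
Local Notation Q := (relfree F k).
Local Notation cls := (@cls F k).
Local Notation scal := (@scal F k).

(* [(false, i)] multiplies by [y_i] on the left, [(true, i)] takes the
   commutator with [y_i]. *)
Definition act (x : bool * nat) (t : fterm F) : fterm F :=
  if x.1 then fcomm t (y_ F x.2) else FMul (y_ F x.2) t.

(** The last operator of the list acts first; [count fst m] is the number of commutators. *)
Definition oddmon j (m : seq (bool * nat)) : fterm F := foldr act (z_ F j) m.
Definition evenmon (a : seq nat) : fterm F :=
  foldr (fun i => FMul (y_ F i)) (FConst 1) a.

Definition qact (x : bool * nat) (q : Q) : Q :=
  if x.1 then q * cls (y_ F x.2) - cls (y_ F x.2) * q else cls (y_ F x.2) * q.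

Lemma cls_act x t : cls (act x t) = qact x (cls t).
Proof. by case: x => -[] i; rewrite /act /= ?cls_comm ?cls_mul. Qed.

Lemma cls_oddmon j m : cls (oddmon j m) = foldr qact (cls (z_ F j)) m.
Proof. by elim: m => //= x m <-; rewrite cls_act. Qed.

Lemma cls_yC i j : cls (y_ F i) * cls (y_ F j) = cls (y_ F j) * cls (y_ F i).
Proof.
apply/eqP; rewrite -subr_eq0 -cls_comm; apply/eqP/cls_eq0.
pose s v := if v == (false, 1%N) then y_ F i
            else if v == (false, 2%N) then y_ F j else FVar F v.
apply: (@T2_subst _ _ (fcomm (y_ F 1) (y_ F 2)) s); first by apply: T2_gen; left.
move=> v w; rewrite /s; case: (v =P (false, 1%N)) => [->|_]; first exact: homog_var.
by case: (v =P (false, 2%N)) => [->|_]; apply: homog_var.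
Qed.

Lemma cls_odd_mul0 t u : homog true t -> homog true u -> cls t * cls u = 0.
Proof.
move=> ht hu; rewrite -cls_mul; apply/cls_eq0.
pose s v := if v == (true, 1%N) then t else if v == (true, 2%N) then u else FVar F v.
apply: (@T2_subst _ _ (FMul (z_ F 1) (z_ F 2)) s); first by apply: T2_gen; right; right.
move=> v w; rewrite /s; case: (v =P (true, 1%N)) => [->|_]; first exact: ht.
by case: (v =P (true, 2%N)) => [->|_]; [apply: hu|apply: homog_var].
Qed.

Lemma homog_oddmon j m : homog true (oddmon j m).
Proof.
elim: m => [|[[] i] m IH] /=; first exact: homog_var.
  exact: (homog_comm IH (@homog_var F (false, i))).
exact: (homog_mul (@homog_var F (false, i)) IH).
Qed.

(** Left and right multiplications commute by associativity, and those on one side because the y_i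
    commute modulo the ideal. *)
Lemma qactC x y q : qact x (qact y q) = qact y (qact x q).
Proof.
case: x y => -[] i [[] j]; rewrite /qact /=.
- rewrite !mulrBr !mulrBl !mulrA -[q * _ * _]mulrA (cls_yC j i) !mulrA.
  rewrite (cls_yC i j) !opprD !opprK !addrA; congr (_ + _).
  by rewrite addrAC.
- by rewrite mulrBr !mulrA (cls_yC i j).
- by rewrite mulrBr !mulrA (cls_yC i j).
by rewrite !mulrA cls_yC.
Qed.

Lemma cls_oddmon_perm j m n : perm_eq m n -> cls (oddmon j m) = cls (oddmon j n).
Proof. by rewrite !cls_oddmon; apply: foldr_perm; apply: qactC. Qed.

Lemma cls_evenmon_perm a b : perm_eq a b -> cls (evenmon a) = cls (evenmon b).
Proof.
have E s : cls (evenmon s) = foldr (fun i q => cls (y_ F i) * q) (cls (FConst 1)) s.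
  by elim: s => //= i s <-; rewrite cls_mul.
by rewrite !E; apply: foldr_perm => i j q; rewrite !mulrA cls_yC.
Qed.

Lemma fsubst_flcomm s (t : fterm F) us :
  fsubst s (flcomm t us) = flcomm (fsubst s t) (map (fsubst s) us).
Proof. by elim: us t => //= u us IH t; rewrite [LHS]IH. Qed.

Lemma cls_flcomm0 j ys :
  size ys = (k - 2)%N -> cls (flcomm (z_ F j) [seq y_ F i | i <- ys]) = 0.
Proof.
move=> sys; apply/cls_eq0.
(* The even variables of the generator are numbered from 1, hence the predecessor in the index into
   [ys]. *)
pose s (v : gvar) := if v.1 then (if v.2 == 0%N then z_ F j else FVar F v)
  else y_ F (nth 0%N ys v.2.-1).
have -> : flcomm (z_ F j) [seq y_ F i | i <- ys] =
    fsubst s (flcomm (z_ F 0) [seq y_ F i | i <- iota 1 (k - 2)]).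
  rewrite fsubst_flcomm /= -map_comp; congr flcomm.
  rewrite -{1}(mkseq_nth 0%N ys) sys -map_comp (iotaDl 1 0) -[RHS]map_comp.
  by apply: eq_map.
apply: T2_subst; first by apply: T2_gen; right; left.
move=> [[] i] w; rewrite /s /=; last exact: homog_var.
by case: (i =P 0%N) => _; apply: homog_var.
Qed.

(** The operators can be permuted so that all commutators act first; the innermost k - 2 form an
    instance of the generator, and every operator fixes 0. *)
Lemma cls_oddmon0 j m : (k - 2 <= count fst m)%N -> cls (oddmon j m) = 0.
Proof.
move=> km; have pm : perm_eq m (filter (predC fst) m ++ filter fst m).
  by rewrite perm_sym perm_catC perm_filterC.
rewrite (cls_oddmon_perm j pm) cls_oddmon foldr_cat.
have q0 m' : foldr qact 0 m' = 0.
  by elim: m' => //= x m' ->; rewrite /qact mulr0 mul0r subrr if_same.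
suff -> : foldr qact (cls (z_ F j)) [seq x <- m | x.1] = 0 by [].
have -> : [seq x <- m | x.1] = map (pair true) [seq x.2 | x <- m & x.1].
  rewrite -map_comp -[LHS]map_id; apply/eq_in_map => -[b i].
  by rewrite mem_filter /= => /andP[->].
set us := [seq x.2 | x <- _]; have sus : (k - 2 <= size us)%N by rewrite !size_map size_filter.
rewrite -(cat_take_drop (size us - (k - 2)) us) map_cat foldr_cat.
set vs := drop _ _; have svs : size vs = (k - 2)%N by rewrite size_drop subKn.
(* [foldr] starts from the last operator, the left-normed commutator from the first, hence [rev]. *)
rewrite -cls_oddmon (_ : oddmon _ _ = flcomm (z_ F j) [seq y_ F i | i <- rev vs]).
  by rewrite cls_flcomm0 ?size_rev.
rewrite /flcomm map_rev foldl_rev /oddmon.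
by elim: vs {svs} => //= i vs ->.
Qed.

Section Span.
Variables (I : Type) (g : I -> Q).

Definition spanned q := exists L : seq (F * I), q = \sum_(x <- L) scal x.1 * g x.2.

Lemma spanned0 : spanned 0.
Proof. by exists [::]; rewrite big_nil. Qed.

Lemma spanned_add p q : spanned p -> spanned q -> spanned (p + q).
Proof. by move=> [L ->] [M ->]; exists (L ++ M); rewrite big_cat. Qed.

Lemma spanned_scal a q : spanned q -> spanned (scal a * q).
Proof.
move=> [L ->]; exists [seq (a * x.1, x.2) | x <- L].
by rewrite big_map mulr_sumr; apply: eq_bigr => x _; rewrite mulrA -scalM.
Qed.

Lemma spanned_gen i : spanned (g i).
Proof. by exists [:: (1, i)]; rewrite big_seq1; apply/esym/mul1r. Qed.

End Span.

Lemma spanned_mul (I I1 I2 : Type) (g : I -> Q) (g1 : I1 -> Q) (g2 : I2 -> Q) :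
  (forall i j, spanned g (g1 i * g2 j)) ->
  forall p q, spanned g1 p -> spanned g2 q -> spanned g (p * q).
Proof.
move=> h p q [L ->] [M ->]; rewrite mulr_suml.
elim/big_ind: _ => [||x _]; [exact: spanned0|exact: spanned_add|].
rewrite mulr_sumr; elim/big_ind: _ => [||y _]; [exact: spanned0|exact: spanned_add|].
rewrite -mulrA; apply: spanned_scal; rewrite mulrA -scalC -mulrA.
exact: spanned_scal.
Qed.

Definition evenspan := spanned (fun a => cls (evenmon a)).
Definition oddspan := spanned (fun x : nat * seq (bool * nat) => cls (oddmon x.1 x.2)).

Lemma evenmon_mul a b : cls (evenmon a) * cls (evenmon b) = cls (evenmon (a ++ b)).
Proof. by elim: a => [|i a IH]; [apply: mul1r|rewrite /= !cls_mul -mulrA IH]. Qed.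

Lemma even_oddmon a j m :
  cls (evenmon a) * cls (oddmon j m) = cls (oddmon j (map (pair false) a ++ m)).
Proof. by elim: a => [|i a IH]; [apply: mul1r|rewrite /= !cls_mul -mulrA IH]. Qed.

(** The identity q y = [q, y] + y q absorbs the even variables one at a time. *)
Lemma odd_evenmon j m a : oddspan (cls (oddmon j m) * cls (evenmon a)).
Proof.
elim: a m => [|i a IH] m.
  by rewrite (mulr1 (cls (oddmon j m))); apply: (spanned_gen _ (j, m)).
rewrite [evenmon _]/= cls_mul mulrA.
have -> : cls (oddmon j m) * cls (y_ F i) =
    cls (oddmon j ((true, i) :: m)) + cls (oddmon j ((false, i) :: m)).
  by rewrite /= !cls_act /qact /= subrK.
by rewrite mulrDl; apply: spanned_add; apply: IH.
Qed.

(** The shape survives products: even times even is even, mixed products are odd, and odd times odd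
    vanishes. *)
Lemma normal_form t : exists p q, [/\ evenspan p, oddspan q & cls t = p + q].
Proof.
elim: t => [[[] i]|c|t [p [q [ep oq E]]] u [p' [q' [ep' oq' E']]]
  |t [p [q [ep oq E]]] u [p' [q' [ep' oq' E']]]].
- exists 0, (cls (z_ F i)); split; [exact: spanned0| |by rewrite add0r].
  exact: (spanned_gen _ (i, [::])).
- exists (cls (y_ F i)), 0; split; [|exact: spanned0|by rewrite addr0].
  have -> : cls (y_ F i) = cls (evenmon [:: i]) by rewrite cls_mul; apply/esym/mulr1.
  exact: spanned_gen.
- exists (scal c), 0; split; [|exact: spanned0|by rewrite addr0].
  by exists [:: (c, [::])]; rewrite big_seq1; apply/esym/mulr1.
- exists (p + p'), (q + q'); split; try exact: spanned_add.
  by rewrite cls_add E E' addrACA.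
exists (p * p'), (p * q' + q * p'); split.
- by apply: (spanned_mul _ ep ep') => a b; rewrite evenmon_mul; apply: spanned_gen.
- apply: spanned_add.
    apply: (spanned_mul _ ep oq') => a [j m]; rewrite even_oddmon.
    exact: (spanned_gen _ (j, map (pair false) a ++ m)).
  by apply: (spanned_mul _ oq ep') => -[j m] a; apply: odd_evenmon.
have qq : q * q' = 0.
  have [L ->] := oq; have [M ->] := oq'; rewrite mulr_suml big1 // => x _.
  rewrite mulr_sumr big1 // => y _.
  rewrite mulrA -[_ * _ * scal _]mulrA -scalC -!mulrA.
  by rewrite cls_odd_mul0 ?mulr0 //; apply: homog_oddmon.
by rewrite cls_mul E E' mulrDl !mulrDr qq addr0 addrA.
Qed.

End NormalForm.

(** * Generic evaluation *)

Section GenericEvaluation.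
Variables (F : fieldType) (K : nat).
Hypothesis K2 : (2 <= K)%N.

(** The matrix E' = E - e_12; dropping e_12 makes it even. *)
Definition shift_mx : 'M[F]_K :=
  \matrix_(i, j) ((i != 0 :> nat) && (j == i.+1 :> nat))%:R.

Definition generic_assign (c u s : nat -> F) (v : gvar) : 'M[F]_K :=
  if v.1 then s v.2 *: eunit F K 0 1 else (c v.2)%:M + u v.2 *: shift_mx.

(** Two commuting variables for each y_i: c_i for left multiplication, u_i for the commutator. *)
Definition mixed_val (c u : nat -> F) (x : bool * nat) : F :=
  if x.1 then u x.2 else c x.2.

Lemma toeplitz_eunit p : (0 < p)%N -> toeplitz (fun=> 0) (eunit F K 0 p).
Proof.
move=> p0 i j ij; rewrite mxE if_same; case: andP => // -[/eqP i0 /eqP jp].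
by move: ij p0; rewrite i0 -jp => /= /eqP ->.
Qed.

Lemma toeplitz_even (x y : F) :
  toeplitz (fun n => if n == 0%N then x else if n == 1%N then y else 0)
    (x%:M + y *: shift_mx).
Proof.
move=> i j ij; rewrite !mxE -val_eqE /=.
have [lij|lji|e] := ltngtP i j.
- rewrite subn_eq0 leqNgt lij /= add0r.
  have -> : (j - i == 1)%N = (j == i.+1 :> nat) by lia.
  have -> : (i != 0 :> nat) by lia.
  by case: eqP; rewrite ?mulr1 ?mulr0.
- by case: (nat_of_ord j =P i.+1) => [e|_]; [lia|rewrite andbF mulr0 addr0].
have -> : (j == i.+1 :> nat) = false by lia.
by rewrite e subnn andbF mulr0 addr0.
Qed.

Lemma Nk_eunit p : (0 < p)%N -> Nk (eunit F K 0 p).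
Proof. by move=> p0; apply/NkP => //; eexists; apply: toeplitz_eunit. Qed.

Lemma Nk_shift : Nk shift_mx.
Proof.
apply/NkP => //; eexists; rewrite -[shift_mx]add0r -[shift_mx]scale1r.
by rewrite -(raddf0 (@scalar_mx F K)); apply: toeplitz_even.
Qed.

Lemma Nk_generic_assign c u s : Nk_assign (generic_assign c u s).
Proof.
move=> [[] n]; rewrite /generic_assign /=.
  apply: Nk_hom_scale => //; split; first exact: Nk_eunit.
  move=> i j; rewrite mxE; case: andP => // -[/eqP -> /eqP ->].
  by [].
apply: Nk_hom_add => //; first exact: Nk_hom_scalar.
apply: Nk_hom_scale => //; split; first exact: Nk_shift.
move=> i j; rewrite mxE; case: andP => // -[/negPf -> /eqP ->].
by [].
Qed.

(** For p >= K - 1 both sides are 0, as [eunit] vanishes when its column is out of range. *)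
Lemma eunit_shift p : (0 < p)%N ->
  eunit F K 0 p *m shift_mx = eunit F K 0 p.+1.
Proof.
move=> p0; apply/matrixP => i j; rewrite !mxE.
under eq_bigr do rewrite !mxE -natrM mulnb.
have [pK|Kp] := ltnP p K.
  rewrite (bigD1 (Ordinal pK)) //= eqxx andbT -lt0n p0 /= big1 ?addr0 // => l /eqP nel.
  by case: (nat_of_ord l =P p) => [e|_]; [case: nel; apply: val_inj|rewrite andbF].
rewrite big1 => [|l _]; last first.
  by case: (nat_of_ord l =P p) => [e|_]; [have := ltn_ord l; lia|rewrite andbF].
by case: (nat_of_ord j =P p.+1) => [e|_]; [have := ltn_ord j; lia|rewrite andbF].
Qed.

Lemma shift_eunit p : shift_mx *m eunit F K 0 p = 0.
Proof.
apply/matrixP => i j; rewrite !mxE big1 // => l _; rewrite !mxE -natrM mulnb.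
by case: (nat_of_ord l =P 0%N) => [->|_]; rewrite ?andbF.
Qed.

(** Left multiplication by y_i acts as c_i because E' e_{1p} = 0; in the commutator c_i cancels and
    u_i E' moves e_{1p} to e_{1,p+1}. *)
Lemma feval_oddmon c u s j m :
  feval (generic_assign c u s) (oddmon F j m) =
    (s j * monomial (mixed_val c u) m) *: eunit F K 0 (count fst m).+1.
Proof.
elim: m => [|[b i] m IH]; first by rewrite /= /monomial big_nil mulr1.
rewrite /monomial big_cons -/(monomial _ m) /mixed_val; case: b.
  rewrite [oddmon _ _ _]/(fcomm (oddmon F j m) (y_ F i)) feval_comm IH.
  rewrite /= /generic_assign /= mulmxDr mulmxDl.
  rewrite -!scalemxAl -!scalemxAr eunit_shift // shift_eunit !scaler0 addr0.
  rewrite mul_mx_scalar mul_scalar_mx addrAC subrr add0r.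
  by rewrite add1n !scalerA [u i * _]mulrC mulrA.
rewrite /= IH /generic_assign /= mulmxDl -!scalemxAl -!scalemxAr shift_eunit !scaler0 addr0.
by rewrite mul_scalar_mx scalerA mulrCA [_ * c i]mulrC.
Qed.

Lemma feval_evenmon_hom c u s a :
  Nk_hom false (feval (generic_assign c u s) (evenmon F a)).
Proof.
elim: a => [|i a IH] /=; first exact: Nk_hom_scalar.
by apply: (Nk_hom_mul K2 (Nk_generic_assign c u s (false, i)) IH).
Qed.

(** The first two diagonals hold the value at c and the derivative along u; for u = c the latter is
    the degree times the monomial, by Euler's formula. *)
Lemma feval_evenmon c u s a : exists e,
  [/\ toeplitz e (feval (generic_assign c u s) (evenmon F a)),
      e 0%N = monomial c a &
      u =1 c -> e 1%N = (size a)%:R * monomial c a].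
Proof.
elim: a => [|i a [e [te e0 e1]]].
  eexists; split; first exact: toeplitz_scalar.
    by rewrite /monomial big_nil.
  by rewrite mul0r.
eexists; split; first exact: toeplitz_mul (toeplitz_even (c i) (u i)) te.
  by rewrite /conv big_ord1 /= e0 /monomial big_cons.
move=> uc; rewrite /conv big_ord_recl big_ord1 /= subnn subn0 e0 e1 // uc.
by rewrite /monomial big_cons -addn1 natrD mulrDl mul1r mulrCA.
Qed.

Definition lincomb (I : Type) (g : I -> fterm F) (L : seq (F * I)) : fterm F :=
  foldr (fun x t => FAdd (FMul (FConst x.1) (g x.2)) t) (FConst 0) L.

Lemma feval_lincomb (I : Type) (g : I -> fterm F) (L : seq (F * I)) r :
  feval r (lincomb g L) = \sum_(x <- L) x.1 *: (feval r (g x.2) : 'M[F]_K).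
Proof.
elim: L => [|x L IH] /=; first by rewrite big_nil raddf0.
by rewrite big_cons IH mul_scalar_mx.
Qed.

Lemma cls_lincomb k (I : Type) (g : I -> fterm F) (L : seq (F * I)) :
  cls k (lincomb g L) = \sum_(x <- L) scal k x.1 * cls k (g x.2).
Proof.
elim: L => [|x L IH] /=; first by rewrite big_nil.
by rewrite big_cons -IH cls_add cls_mul.
Qed.

Definition normal_term (L : seq (F * seq nat)) (M : seq (F * (nat * seq (bool * nat)))) :=
  FAdd (lincomb (@evenmon F) L) (lincomb (fun x => oddmon F x.1 x.2) M).

Lemma normal_term_diag c u s L M (i : 'I_K) :
  feval (generic_assign c u s) (normal_term L M) i i
    = \sum_(x <- L) x.1 * monomial c x.2.
Proof.
rewrite /= mxE !feval_lincomb !summxE [X in _ + X]big1 ?addr0; last first.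
  move=> x _; rewrite feval_oddmon !mxE; case: andP => [[/eqP -> //]|_].
  by rewrite !mulr0.
apply: eq_bigr => x _; rewrite mxE.
have [e [te <- _]] := feval_evenmon c u s x.2.
by rewrite te ?leqnn ?subnn //; case: (nat_of_ord i).
Qed.

Lemma normal_term_superdiag c s L M (i j : 'I_K) : i != 0 :> nat -> j = i.+1 :> nat ->
  feval (generic_assign c c s) (normal_term L M) i j
    = \sum_(x <- L) x.1 * (size x.2)%:R * monomial c x.2.
Proof.
move=> i0 ji; rewrite /= mxE !feval_lincomb !summxE [X in _ + X]big1 ?addr0; last first.
  by move=> x _; rewrite feval_oddmon !mxE (negPf i0) !mulr0.
apply: eq_bigr => x _; rewrite mxE -mulrA.
have [e [te _ <-]] // := feval_evenmon c c s x.2.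
by rewrite te ?i0 // ji leqnSn subSnn.
Qed.

(** Even monomials vanish here by the grading, and odd ones reach this column exactly when they
    contain q commutators. *)
Lemma normal_term_row0 c u s L M (i j : 'I_K) q : i = 0%N :> nat -> j = q.+1 :> nat ->
  feval (generic_assign c u s) (normal_term L M) i j
    = \sum_(x <- M | count fst x.2.2 == q)
        x.1 * (s x.2.1 * monomial (mixed_val c u) x.2.2).
Proof.
move=> i0 jq; rewrite /= mxE !feval_lincomb !summxE [X in X + _]big1 ?add0r; last first.
  move=> x _; rewrite mxE; have [_ ->] := feval_evenmon_hom c u s x.2.
    by rewrite mulr0.
  by rewrite i0 jq.
rewrite [RHS]big_mkcond; apply: eq_bigr => x _.
rewrite feval_oddmon !mxE i0 jq eqxx eqSS eq_sym /=.
by case: ifP => _; rewrite ?mulr1 ?mulr0.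
Qed.

End GenericEvaluation.

(** * Identities and central polynomials lie in the T_2-ideal *)

Section Completeness.
Variables (F : fieldType) (k : nat).
Hypothesis charF0 : [pchar F] =i pred0.
Hypothesis k3 : (3 <= k)%N.

Lemma normal_term_cls t : exists L M,
  cls k t = cls k (normal_term L M) /\
  forall x : F * (nat * seq (bool * nat)), x \in M -> (count fst x.2.2 < k - 2)%N.
Proof.
have [p [q [[L ->] [M ->] E]]] := normal_form k t.
exists L, [seq x <- M | (count fst x.2.2 < k - 2)%N]; split; last first.
  by move=> x; rewrite mem_filter => /andP[].
rewrite E /normal_term cls_add !cls_lincomb; congr (_ + _).
rewrite big_filter [RHS]big_mkcond; apply: eq_bigr => x _.
by case: ltnP => // /cls_oddmon0 ->; rewrite mulr0.
Qed.

Lemma scal_additive_action (q : relfree F k) :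
  {morph (fun a => scal k a * q) : a b / a + b}.
Proof. by move=> a b; rewrite scalD mulrDl. Qed.

Lemma cls_lincomb_even_eq0 (L : seq (F * seq nat)) :
  (forall a, \sum_(x <- L | perm_eq a x.2) x.1 = 0) ->
  cls k (lincomb (@evenmon F) L) = 0.
Proof.
move=> L0; rewrite cls_lincomb.
apply: (@sum_classes_eq0 _ _ _ (@perm_eq _)
  (fun a m => scal k a * cls k (evenmon F m))) => //.
- by move=> a b /permPl.
- by move=> m; apply: scal_additive_action.
- by move=> a b /(cls_evenmon_perm F k) -> c.
Qed.

(** A choice of [s] separates the z_j, and the relations for the various q add up to one relation in
    the doubled variables. *)
Lemma cls_lincomb_odd_eq0 (M : seq (F * (nat * seq (bool * nat)))) :
  (forall x, x \in M -> (count fst x.2.2 < k - 2)%N) ->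
  (forall c u s q, (q < k - 2)%N ->
    \sum_(x <- M | count fst x.2.2 == q)
      x.1 * (s x.2.1 * monomial (mixed_val c u) x.2.2) = 0) ->
  cls k (lincomb (fun x => oddmon F x.1 x.2) M) = 0.
Proof.
move=> Mk M0; rewrite cls_lincomb.
apply: (@sum_classes_eq0 _ _ _ (fun i j => (i.1 == j.1) && perm_eq i.2 j.2)
  (fun a m => scal k a * cls k (oddmon F m.1 m.2))) => //.
- by move=> i; rewrite /= eqxx perm_refl.
- by move=> [i a] [j b] /= /andP[/eqP -> /permPl ab] [l c] /=; rewrite ab.
- by move=> m; apply: scal_additive_action.
- by move=> [i a] [j b] /= /andP[/eqP -> /(cls_oddmon_perm F k j) ->] c.
move=> [j m] /=.
pose Mj := [seq (x.1, x.2.2) | x <- M & x.2.1 == j].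
have := @monomial_indep _ _ charF0 Mj _ m; rewrite big_map big_filter_cond /=.
under eq_bigl do rewrite [_ == j]eq_sym.
apply=> v; rewrite big_map big_filter.
(* The indicator of [j] keeps only the monomials built on z_j. *)
pose s i : F := (i == j)%:R.
transitivity (\sum_(q < k - 2) \sum_(x <- M | count fst x.2.2 == q)
    x.1 * (s x.2.1 * monomial v x.2.2)); last first.
  apply: big1 => q _.
  have <- : mixed_val (fun i => v (false, i)) (fun i => v (true, i)) = v.
    by apply/funext => -[[] i].
  exact: M0.
(* Each monomial of [M] occurs for a single q, its number of commutators. *)
rewrite (exchange_big_dep xpredT) //= big_mkcond; apply: eq_big_seq => x xM.
rewrite (big_pred1 (Ordinal (Mk x xM))) /s; last first.
  by move=> q; rewrite eq_sym.
by case: eqP; rewrite ?mul1r // mul0r mulr0.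
Qed.

Lemma T2ideal_of_vanishing t L M :
  cls k t = cls k (normal_term L M) ->
  (forall x : F * (nat * seq (bool * nat)), x \in M -> (count fst x.2.2 < k - 2)%N) ->
  (forall a, \sum_(x <- L | perm_eq a x.2) x.1 = 0) ->
  (forall c u s q, (q < k - 2)%N ->
    \sum_(x <- M | count fst x.2.2 == q)
      x.1 * (s x.2.1 * monomial (mixed_val c u) x.2.2) = 0) ->
  T2ideal (gens37 (F := F) k) t.
Proof.
move=> tLM Mk L0 M0; apply/cls_eq0; rewrite tLM cls_add.
by rewrite cls_lincomb_even_eq0 // cls_lincomb_odd_eq0 ?addr0.
Qed.

(** The difference lies in the ideal, so its value is a multiple of e_{1k}, hence 0 when K < k. *)
Lemma cls_feval K t u (r : gvar -> 'M[F]_K) (i j : 'I_K) :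
  (2 <= K)%N -> (K <= k)%N -> Nk_assign r -> cls k t = cls k u ->
  ~~ ((i == 0 :> nat) && (j == k.-1 :> nat)) ->
  feval r t i j = feval r u i j.
Proof.
move=> K2 Kk rK /clsP/asboolP/(T2ideal_corner K2 Kk (ltnW k3)) tu ij.
by have := tu _ rK _ _ ij; rewrite /= mul_scalar_mx scaleN1r !mxE => /eqP; rewrite subr_eq0 => /eqP.
Qed.

(** In size k - 1 the diagonal yields the even part, and the columns q + 1 with q < k - 2 yield the
    odd part. *)
Lemma grId_T2ideal t : grId (k - 1) t -> T2ideal (gens37 (F := F) k) t.
Proof.
move=> tid; have [L [M [tLM Mk]]] := normal_term_cls t.
have K2 : (2 <= k - 1)%N by lia.
have E c u s (i j : 'I_(k - 1)) :
    feval (generic_assign (k - 1) c u s) (normal_term L M) i j = 0.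
  rewrite -(@cls_feval _ t) ?leq_subr //; first 1 last.
  - exact: Nk_generic_assign.
  - by rewrite negb_and; apply/orP; right; have := ltn_ord j; lia.
  by rewrite tid ?mxE //; apply: Nk_generic_assign.
apply: (T2ideal_of_vanishing tLM Mk).
  apply: monomial_indep => // c.
  have k0 : (0 < k - 1)%N by lia.
  by rewrite -(normal_term_diag K2 c c c L M (Ordinal k0)) E.
move=> c u s q qk; have k0 : (0 < k - 1)%N by lia.
have q1 : (q.+1 < k - 1)%N by lia.
by rewrite -(@normal_term_row0 _ _ K2 c u s L M (Ordinal k0) (Ordinal q1)) ?E.
Qed.

(** Compare the entries (0, j + 1) of a E' and E' a: the first is [a i j], the second 0 since row 0
    of E' is zero. *)
Lemma Nk_center_row0 (a : 'M[F]_k) (i j : 'I_k) :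
  Nk_center a -> i = 0%N :> nat -> (0 < j < k.-1)%N -> a i j = 0.
Proof.
move=> [_ ca] i0 /andP[j0 jk]; have j1 : (j.+1 < k)%N by lia.
have := congr1 (fun b : 'M_k => b i (Ordinal j1)) (ca _ (Nk_shift F (ltnW k3))).
rewrite !mxE [RHS]big1 => [|l _]; last by rewrite mxE i0 mul0r.
rewrite (bigD1 j) //= mxE -lt0n j0 eqxx mulr1 big1 ?addr0 // => l /eqP nel.
rewrite mxE; case: (j.+1 =P l.+1) => [e|_]; last by rewrite andbF mulr0.
by case: nel; apply: val_inj; case: e.
Qed.

(** Compare the entries (0, 2) of the two products of [a] with [eunit F k 0 1]: with [a] on the
    right it is [a i j], on the left 0. *)
Lemma Nk_center_superdiag (a : 'M[F]_k) (i j : 'I_k) :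
  Nk_center a -> i = 1%N :> nat -> j = 2%N :> nat -> a i j = 0.
Proof.
move=> [_ ca] i1 j2; have k0 : (0 < k)%N by lia.
have := congr1 (fun b : 'M_k => b (Ordinal k0) j) (ca _ (Nk_eunit F (ltnW k3) (ltn0Sn 0))).
rewrite !mxE big1 => [|l _]; last by rewrite mxE j2 andbF mulr0.
move/esym; rewrite (bigD1 i) //= mxE i1 eqxx mul1r big1 ?addr0 // => l /eqP nel.
rewrite mxE; case: (nat_of_ord l =P 1%N) => [e|_]; last by rewrite andbF mul0r.
by case: nel; apply: val_inj; rewrite /= i1 e.
Qed.

Lemma grCentral_T2ideal t : grCentral k t -> T2ideal (gens37 (F := F) k) t.
Proof.
move=> [t0 tc]; have [L [M [tLM Mk]]] := normal_term_cls t.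
have K2 : (2 <= k)%N := ltnW k3.
have k0 : (0 < k)%N := ltnW K2.
have E c u s := tc _ (Nk_generic_assign K2 c u s).
apply: (T2ideal_of_vanishing tLM Mk); last first.
  move=> c u s q qk; have q1 : (q.+1 < k)%N by lia.
  rewrite -(@normal_term_row0 _ _ K2 c u s L M (Ordinal k0) (Ordinal q1)) //.
  rewrite -(@cls_feval _ t) //; first 1 last.
  - exact: Nk_generic_assign.
  - by rewrite /=; lia.
  by apply: Nk_center_row0 => //=; lia.
(* The Euler derivative loses the constant term, so the empty monomial is treated apart, by the zero
   assignment and [t0]. *)
move=> [|a0 a].
  have := @normal_term_diag _ _ K2 (fun=> 0) (fun=> 0) (fun=> 0) L M (Ordinal k0).
  rewrite -(@cls_feval _ t) //; first 1 last.
  - exact: Nk_generic_assign.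
  - by rewrite /=; lia.
  have -> : generic_assign k (fun=> 0) (fun=> 0) (fun=> 0) = fun=> 0 :> 'M[F]_k.
    by apply/funext => -[[] i]; rewrite /generic_assign /= ?raddf0 scale0r ?addr0.
  rewrite feval0 t0 raddf0 mxE => /esym E0; rewrite -[RHS]E0 big_mkcond.
  apply: eq_bigr => -[x [|b m]] _ /=; first by rewrite /monomial big_nil mulr1.
  rewrite /monomial big_cons mul0r mulr0; case: ifP => //.
  by move=> /perm_size.
(* The Euler derivative of the even part. *)
pose L' := [seq (x.1 * (size x.2)%:R, x.2) | x <- L].
have L'0 c : \sum_(x <- L') x.1 * monomial c x.2 = 0.
  rewrite big_map /=; have k1 : (1 < k)%N := K2.
  rewrite -(@normal_term_superdiag _ _ K2 c c L M (Ordinal k1) (Ordinal k3)) //.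
  rewrite -(@cls_feval _ t) //; last exact: Nk_generic_assign.
  exact: Nk_center_superdiag.
have := monomial_indep charF0 L'0 (a0 :: a); rewrite big_map /=.
(* The class has one common positive degree, which is nonzero in characteristic zero and cancels. *)
rewrite (eq_bigr (fun x => x.1 * (size (a0 :: a))%:R)) => [|x /perm_size -> //].
by rewrite -mulr_suml => /eqP; rewrite mulf_eq0 ((pcharf0P F).1 charF0) orbF => /eqP.
Qed.

(** In size k - 1 the corner position (0, k - 1) lies outside the matrix. *)
Lemma T2ideal_grId t : T2ideal (gens37 (F := F) k) t -> grId (k - 1) t.
Proof.
move=> tJ r rK; apply/matrixP => i j; rewrite mxE.
have K2 : (2 <= k - 1)%N by lia.
apply: (T2ideal_corner K2 (leq_subr 1 k) (ltnW k3) tJ rK).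
by have := ltn_ord j; lia.
Qed.

Lemma T2ideal_grCentral t : T2ideal (gens37 (F := F) k) t -> grCentral k t.
Proof.
move=> tJ; have K2 : (2 <= k)%N := ltnW k3; split=> [|r rK]; last first.
  apply: (corner_center K2 (leqnn k)); first exact: Nk_feval.
  exact: (T2ideal_corner K2 (leqnn k) K2 tJ rK).
have k0 : (0 < k)%N := ltnW K2.
(* The zero assignment shows the constant term at entry (0, 0), which is not the corner. *)
have := @T2ideal_corner _ _ K2 _ (leqnn k) K2 _ tJ (fun=> 0).
move=> /(_ (fun v => Nk_hom0 F v.1 K2) (Ordinal k0) (Ordinal k0)).
rewrite feval0 mxE eqxx; apply; rewrite /=; lia.
Qed.

End Completeness.

Theorem theorem3p7 (F : fieldType) (charF0 : [pchar F] =i pred0)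
  (k : nat) (hk : (3 <= k)%N) (t : fterm F) :
  (grCentral k t <-> grId (k - 1) t) /\
  (grId (k - 1) t <-> T2ideal (gens37 (F:=F) k) t).
Proof.
split; split.
- by move=> /(grCentral_T2ideal charF0 hk)/(T2ideal_grId hk).
- by move=> /(grId_T2ideal charF0 hk)/(T2ideal_grCentral hk).
- exact: grId_T2ideal.
- exact: T2ideal_grId.
Qed.
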